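(* For every $n\in\mathbb{N}$ (i.e. $n\geq 1$), every compact subset of the closed unit ball $\overline{B}^{2n}\subseteq\mathbb{R}^{2n}$ with vanishing $(2n-1)$-dimensional Hausdorff measure symplectically embeds into the open cylinder $Z^{2n}$.
   Context: $\mathbb{R}^{2n}=(\mathbb{R}^2)^n$ carries the standard symplectic form $\omega_0=\sum_{i=1}^n dq_i\wedge dp_i$, where $(q_i,p_i)$ are the coordinates on the $i$-th factor $\mathbb{R}^2$. Let $(M,\omega)$ and $(M',\omega')$ be symplectic manifolds and $X\subseteq M$ a subset. We say that $X$ (symplectically) embeds into $M'$ iff there exist an open neighborhood $U\subseteq M$ of $X$ and a symplectic embedding $\varphi\colon U\to M'$ (a smooth embedding with $\varphi^*\omega'=\omega|_U$). Here $M=\mathbb{R}^{2n}$ and $M'=Z^{2n}$, both with the form $\omega_0$. $\overline{B}^{2n}$ is the closed ball of radius $1$ around $0$ in $\mathbb{R}^{2n}$, and $Z^{2n}:=B^2\times\mathbb{R}^{2n-2}$, where $B^2\subseteq\mathbb{R}^2$ is the open unit disk around $0$. *)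

(* Defs.v *)
(* MathComp-Analysis. *)
From HB Require Import structures.
From mathcomp Require Import all_boot all_order all_algebra.
From mathcomp Require Import all_classical all_reals all_analysis.

Set Implicit Arguments.
Unset Strict Implicit.
Unset Printing Implicit Defensive.

Import Order.TTheory GRing.Theory Num.Theory.
Import numFieldNormedType.Exports.

Local Open Scope classical_set_scope.
Local Open Scope ring_scope.

(* The space (R^2)^n: row i of x is the i-th factor, x i 0 is the coordinate
   q_i and x i 1 is the coordinate p_i. *)
Notation phase R n := ('M[R]_(n, 2)).

(* The library norm on matrices is the sup norm (same topology), hence the
   explicit Euclidean norm. *)
Definition enorm (R : realType) (n : nat) (x : phase R n) : R :=
  Num.sqrt (\sum_(i < n) (x i 0 ^+ 2 + x i 1 ^+ 2)).

Definition closed_unit_ball (R : realType) (n : nat) : set (phase R n) :=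
  [set x | enorm x <= 1].
Arguments closed_unit_ball : clear implicits.

(* B^2 x R^(2n-2); the disk lies in the first factor R^2, which exists since
   0 < n. *)
Definition cylinder (R : realType) (n : nat) (n_gt0 : (0 < n)%N) :
    set (phase R n) :=
  [set x | x (Ordinal n_gt0) 0 ^+ 2 + x (Ordinal n_gt0) 1 ^+ 2 < 1].
Arguments cylinder R [n] n_gt0.

(* diam set0 = -oo. *)
Definition diam (R : realType) (n : nat) (A : set (phase R n)) : \bar R :=
  ereal_sup [set (enorm (x.1 - x.2))%:E | x in A `*` A].

Definition diam_pow (R : realType) (n : nat) (s : R) (A : set (phase R n)) :
    \bar R :=
  (if A == set0 then 0 else diam A `^ s)%E.

Definition hausdorff_premeasure (R : realType) (n : nat) (s delta : R)
    (A : set (phase R n)) : \bar R :=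
  ereal_inf [set (\sum_(0 <= k <oo) diam_pow s (C k))%E | C in
    [set C : (set (phase R n))^nat |
      A `<=` \bigcup_k C k /\ forall k, (diam (C k) <= delta%:E)%E]].

(* s-dimensional Hausdorff (outer) measure, s >= 0, for the Euclidean metric and
   without the normalizing factor (a positive constant depending only on s); the
   supremum over delta > 0 is the limit as delta tends to 0. *)
Definition hausdorff_measure (R : realType) (n : nat) (s : R)
    (A : set (phase R n)) : \bar R :=
  ereal_sup [set hausdorff_premeasure s delta A | delta in [set d : R | 0 < d]].

(* f is C^k on the open set U (V finite-dimensional): continuity of
   x |-> 'd f x is expressed vector by vector. *)
Fixpoint Ck_on (R : realType) (V W : normedModType R) (U : set V) (k : nat)
    (f : V -> W) : Prop :=
  (forall x, U x -> {for x, continuous f}) /\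
  match k with
  | 0 => True
  | k'.+1 => (forall x, U x -> differentiable f x) /\
             (forall v, Ck_on U k' (fun x => 'd f x v))
  end.

Definition smooth_on (R : realType) (V W : normedModType R) (U : set V)
    (f : V -> W) : Prop :=
  forall k, Ck_on U k f.

(* Injective immersion of the open set U that is a homeomorphism onto its image;
   only the values of f on U matter. *)
Definition smooth_embedding (R : realType) (V W : normedModType R) (U : set V)
    (f : V -> W) : Prop :=
  [/\ smooth_on U f,
      (forall x, U x -> injective ('d f x)) &
      exists g : W -> V, (forall x, U x -> g (f x) = x) /\
                         {within f @` U, continuous g}].

(* omega_0 = \sum_i dq_i /\ dp_i *)
Definition omega0 (R : realType) (n : nat) (u v : phase R n) : R :=
  \sum_(i < n) (u i 0 * v i 1 - v i 0 * u i 1).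

Definition symplectic_on (R : realType) (n : nat) (U : set (phase R n))
    (f : phase R n -> phase R n) : Prop :=
  forall x, U x -> forall u v, omega0 ('d f x u) ('d f x v) = omega0 u v.

(* The target M' is an open subset of the space, with the restricted form. *)
Definition symplectically_embeds (R : realType) (n : nat)
    (X M' : set (phase R n)) : Prop :=
  exists (U : set (phase R n)) (f : phase R n -> phase R n),
    [/\ open U, X `<=` U, f @` U `<=` M',
        smooth_embedding U f & symplectic_on U f].

(* Main.v *)
Require Import Defs.
From HB Require Import structures.
From mathcomp Require Import all_boot all_order all_algebra.
From mathcomp Require Import all_classical all_reals all_analysis.
From mathcomp Require Import measurable_realfun.
From mathcomp Require Import ring lra zify.

(* Some point z of the unit sphere is not in K: otherwise dropping one coordinate
   would map a null set onto a set containing a (2n-1)-cube. A unitary map L, which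
   is symplectic, sends z to e1 = (1, 0, ..., 0). Since e1 is the only point of the
   closed ball whose first coordinate q is >= 1, compactness gives q <= 1 - d on
   L K for some d > 0. Acting on the first factor, the area-preserving map
   (q, p) |-> (g q, p / g' q) with g q = q + e / (1 - q) and e > 0 small sends the
   part q <= 1 - d of the closed unit disk into the open disk. *)

Set Implicit Arguments.
Unset Strict Implicit.
Unset Printing Implicit Defensive.

Import Order.TTheory GRing.Theory Num.Theory.
Import numFieldNormedType.Exports.

Local Open Scope classical_set_scope.
Local Open Scope ring_scope.

(** * Functions of class C^k *)

(** The first-order expansion of [f] at [x] involves only the germ of [f], so it is also one of [g];
    a continuous linear term in such an expansion is unique. *)
Lemma near_eq_diff (R : realType) (V W : normedModType R) (f g : V -> W) (x : V) :
  (\forall y \near x, f y = g y) -> differentiable f x ->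
  differentiable g x /\ 'd g x = 'd f x :> (V -> W).
Proof.
move=> fg df.
have key : g \o shift x = cst (g x) + 'd f x +o_ 0 id.
  have fgx : f x = g x by exact: (nbhs_singleton fg).
  apply/eqaddoP => _ /posnumP[e].
  have /eqaddoP/(_ _ (gt0 e)) := diff_locally df.
  have fg0 : \forall h \near (0 : V), f (h + x) = g (h + x).
    by rewrite (near_shift x) /=; near=> y; rewrite /= sub0r subrK; near: y.
  move=> H; near=> h.
  have -> : (g \o shift x - (cst (g x) + 'd f x)) h = (f \o shift x - (cst (f x) + 'd f x)) h.
    rewrite !fctE /= fgx; congr (_ - _).
    by symmetry; near: h.
  near: h; exact: H.
have dg := diff_unique (diff_continuous df) key.
by split=> //; apply/diff_locallyP; rewrite dg; split => //; exact: diff_continuous.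
Unshelve. all: by end_near. Qed.

Lemma Ck_on_le (R : realType) (V W : normedModType R) (U : set V) k (f : V -> W) :
  Ck_on U k.+1 f -> Ck_on U k f.
Proof.
elim: k f => [|k IH] f /=; first by case.
move=> [cf [df ddf]]; split=> //; split=> // v; apply: IH; exact: ddf.
Qed.

Lemma Ck_on_continuous (R : realType) (V W : normedModType R) (U : set V) k (f : V -> W) :
  Ck_on U k f -> forall x, U x -> {for x, continuous f}.
Proof. by case: k => [|k] []. Qed.

(** Openness of [U] turns equality on [U] into equality near each of its points, so the
    differentials agree too. This allows a derivative to be replaced by a formula valid only on
    [U]. *)
Lemma Ck_on_eq (R : realType) (V W : normedModType R) (U : set V) k (f g : V -> W) :
  open U -> (forall x, U x -> f x = g x) -> Ck_on U k f -> Ck_on U k g.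
Proof.
move=> oU.
have fgn (f1 f2 : V -> W) x : (forall x, U x -> f1 x = f2 x) -> U x ->
    \forall y \near x, f1 y = f2 y.
  by move=> fg Ux; near=> y; apply: fg; near: y; exact: open_nbhs_nbhs.
have cont (f1 f2 : V -> W) : (forall x, U x -> f1 x = f2 x) ->
    (forall x, U x -> {for x, continuous f1}) -> forall x, U x -> {for x, continuous f2}.
  move=> fg cf x Ux; rewrite /prop_for /continuous_at -(fg x Ux).
  by apply: cvg_trans (cf x Ux); apply: near_eq_cvg; exact: fgn.
elim: k f g => [|k IH] f g fg /=; first by case=> cf _; split => //; exact: cont cf.
move=> [cf [df ddf]]; split; first exact: cont cf.
split=> [x Ux|v]; first by have [] := near_eq_diff (fgn _ _ _ fg Ux) (df x Ux).
apply: IH (ddf v) => x Ux.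
by have [_ ->] := near_eq_diff (fgn _ _ _ fg Ux) (df x Ux).
Unshelve. all: by end_near. Qed.

Lemma Ck_on_cst (R : realType) (V W : normedModType R) (U : set V) k (c : W) :
  Ck_on U k (cst c : V -> W).
Proof.
elim: k c => [|k IH] c; first by split=> // x _; exact: cst_continuous.
split=> [x _|]; first exact: cst_continuous.
split=> [x _|v]; first exact: differentiable_cst.
rewrite (_ : (fun _ => _) = cst (0 : W)); first exact: IH.
by apply/funext => x; rewrite diff_cst.
Qed.

Lemma Ck_on_linear (R : realType) (V W : normedModType R) (U : set V) k
  (f : {linear V -> W}) : continuous f -> Ck_on U k f.
Proof.
case: k => [|k] cf; first by split=> // x _; exact: cf.
split=> [x _|]; first exact: cf.
split=> [x _|v]; first exact: linear_differentiable.
rewrite (_ : (fun _ => _) = cst (f v)); first exact: Ck_on_cst.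
by apply/funext => x; rewrite diff_lin.
Qed.

Lemma Ck_onD (R : realType) (V W : normedModType R) (U : set V) k (f g : V -> W) :
  open U -> Ck_on U k f -> Ck_on U k g -> Ck_on U k (f + g).
Proof.
move=> oU; elim: k f g => [|k IH] f g [cf Hf] [cg Hg].
  by split=> // x Ux; apply: continuousD; [exact: cf|exact: cg].
case: Hf Hg => df ddf [dg ddg].
split=> [x Ux|]; first by apply: continuousD; [exact: cf|exact: cg].
split=> [x Ux|v]; first by apply: differentiableD; [exact: df|exact: dg].
apply: Ck_on_eq oU _ (IH _ _ (ddf v) (ddg v)) => x Ux.
by rewrite diffD //; [exact: df|exact: dg].
Qed.

Lemma Ck_onM (R : realType) (V : normedModType R) (U : set V) k (f g : V -> R) :
  open U -> Ck_on U k f -> Ck_on U k g -> Ck_on U k (f * g).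
Proof.
move=> oU; elim: k f g => [|k IH] f g Hf Hg.
  case: Hf Hg => cf _ [cg _].
  by split=> // x Ux; apply: continuousM; [exact: cf|exact: cg].
(* The Leibniz rule keeps [f] and [g] themselves as factors, needed one order lower. *)
have Hf' := Ck_on_le Hf; have Hg' := Ck_on_le Hg.
case: Hf Hg => cf [df ddf] [cg [dg ddg]].
split=> [x Ux|]; first by apply: continuousM; [exact: cf|exact: cg].
split=> [x Ux|v]; first by apply: differentiableM; [exact: df|exact: dg].
pose dfg : V -> R := f * (fun x => 'd g x v) + g * (fun x => 'd f x v).
apply: (@Ck_on_eq _ _ _ U k dfg) => // [x Ux|].
  by rewrite diffM //; [exact: df|exact: dg].
exact: Ck_onD oU (IH _ _ Hf' (ddg v)) (IH _ _ Hg' (ddf v)).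
Qed.

(** The derivative of [1 / f] is [- (1 / f)^2] times that of [f], and the induction hypothesis
    covers the factor [1 / f]. *)
Lemma Ck_onV (R : realType) (V : normedModType R) (U : set V) k (f : V -> R) :
  open U -> (forall x, U x -> f x != 0) -> Ck_on U k f ->
  Ck_on U k (fun x => (f x)^-1).
Proof.
move=> oU f0; elim: k => [|k IH] Hf.
  by case: Hf => cf _; split=> // x Ux; apply: continuousV; [exact: f0|exact: cf].
have /IH Hv := Ck_on_le Hf.
case: Hf => cf [df ddf].
split=> [x Ux|]; first by apply: continuousV; [exact: f0|exact: cf].
split=> [x Ux|v]; first by apply: differentiableV; [exact: df|exact: f0].
pose c : V -> R := cst (-1).
pose df' : V -> R := (fun x => 'd f x v).
pose fV : V -> R := fun x => (f x)^-1.
apply: (@Ck_on_eq _ _ _ U k (c * (fV * fV) * df')) => // [x Ux|].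
  rewrite diffV //; [|exact: df|exact: f0].
  by rewrite !fctE /= mulN1r expr2 invfM.
apply: Ck_onM => //; last exact: ddf.
by apply: Ck_onM => //; [exact: Ck_on_cst|exact: Ck_onM].
Qed.

Lemma Ck_onZl (R : realType) (V W : normedModType R) (U : set V) k (f : V -> R) (w : W) :
  open U -> Ck_on U k f -> Ck_on U k (fun x => f x *: w).
Proof.
move=> oU; elim: k f => [|k IH] f Hf.
  by case: Hf => cf _; split=> // x Ux; apply: continuousZr_tmp; exact: cf.
case: Hf => cf [df ddf].
split=> [x Ux|]; first by apply: continuousZr_tmp; exact: cf.
split=> [x Ux|v]; first by apply: differentiableZl; exact: df.
apply: Ck_on_eq oU _ (IH _ (ddf v)) => x Ux.
by rewrite diffZl //; exact: df.
Qed.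

(** Finite dimension: [f] is a finite sum of coordinate functions times fixed vectors. *)
Lemma mx_linear_continuous (R : realType) (m n : nat) (W : normedModType R)
  (f : {linear 'M[R]_(m, n) -> W}) : continuous f.
Proof.
have -> : f = (fun x => \sum_(i < m) \sum_(j < n) x i j *: f (delta_mx i j)) :> (_ -> _).
  apply/funext => x; rewrite {1}(matrix_sum_delta x) linear_sum.
  by apply: eq_bigr => i _; rewrite linear_sum; apply: eq_bigr => j _; rewrite linearZ.
apply: continuous_big => [|i _]; first exact: add_continuous.
apply: continuous_big => [|j _]; first exact: add_continuous.
move=> x.
apply: (@continuousZr_tmp _ _ _ (fun x : 'M[R]_(m, n) => x i j)); exact: coord_continuous.
Qed.

(** * Symplectic linear algebra *)

Lemma omega0DZl (R : realType) n a (u v w : phase R n) :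
  omega0 (a *: u + v) w = a * omega0 u w + omega0 v w.
Proof.
rewrite /omega0 mulr_sumr -big_split /=; apply: eq_bigr => i _.
by rewrite !mxE; ring.
Qed.

Lemma omega0C (R : realType) n (u v : phase R n) : omega0 u v = - omega0 v u.
Proof. by rewrite /omega0 -sumrN; apply: eq_bigr => i _; ring. Qed.

Lemma omega0DZr (R : realType) n a (u v w : phase R n) :
  omega0 w (a *: u + v) = a * omega0 w u + omega0 w v.
Proof. by rewrite omega0C omega0DZl (omega0C w u) (omega0C w v); ring. Qed.

(* Multiplication by the imaginary unit, for z_i = q_i + i p_i. *)
Definition mulI (R : realType) n (x : phase R n) : phase R n :=
  \matrix_(i, j) (if j == 0 then - x i 1 else x i 0).

Lemma mulI_DZ (R : realType) n a (u v : phase R n) :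
  mulI (a *: u + v) = a *: mulI u + mulI v.
Proof.
by apply/matrixP => i j; rewrite !mxE; case: eqP => _; rewrite ?mxE //; ring.
Qed.

Lemma mulIK (R : realType) n (x : phase R n) : mulI (mulI x) = - x.
Proof.
apply/matrixP => i j; rewrite !mxE.
by case: j => [[|[|//]]] /= ?; congr (- x i _); apply/val_inj.
Qed.

Lemma omega0_mulI (R : realType) n (u v : phase R n) :
  omega0 (mulI u) (mulI v) = omega0 u v.
Proof. by apply: eq_bigr => i _; rewrite !mxE /=; ring. Qed.

Lemma omega0_mulIr (R : realType) n (x : phase R n) :
  omega0 x (mulI x) = \sum_(i < n) (x i 0 ^+ 2 + x i 1 ^+ 2).
Proof. by apply: eq_bigr => i _; rewrite !mxE /=; ring. Qed.

Lemma ord2P (j : 'I_2) : j = 0 \/ j = 1.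
Proof. by case: j => [[|[|//]] ?]; [left|right]; apply/val_inj. Qed.

Lemma enorm_sqr (R : realType) n (x : phase R n) :
  enorm x ^+ 2 = \sum_(i < n) (x i 0 ^+ 2 + x i 1 ^+ 2).
Proof. by rewrite sqr_sqrtr // sumr_ge0 // => i _; rewrite addr_ge0 ?sqr_ge0. Qed.

Lemma coord_sqr_le_enorm (R : realType) n (x : phase R n) i :
  x i 0 ^+ 2 + x i 1 ^+ 2 <= enorm x ^+ 2.
Proof.
rewrite enorm_sqr (bigD1 i) //= lerDl sumr_ge0 // => j _.
by rewrite addr_ge0 ?sqr_ge0.
Qed.

Lemma coord_le_enorm (R : realType) n (x : phase R n) i j : `|x i j| <= enorm x.
Proof.
rewrite -(@ler_pXn2r _ 2) ?nnegrE ?sqrtr_ge0 // real_normK ?num_real //.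
apply: le_trans (coord_sqr_le_enorm x i).
case: (ord2P j) => ->.
- by rewrite lerDl sqr_ge0.
- by rewrite lerDr sqr_ge0.
Qed.

Lemma enorm_eq0 (R : realType) n (x : phase R n) : enorm x = 0 -> x = 0.
Proof.
move=> x0; apply/matrixP => i j; rewrite mxE; apply/eqP.
by rewrite -normr_le0 -x0 coord_le_enorm.
Qed.

(* The complex rank-one modification of the identity x |-> x - <x, v> v / <z, v>,
   v = z - e, for the Hermitian product <x, y> = omega0 x (mulI y) + i omega0 y x. *)
Lemma unitary_transitive (R : realType) n (z e : phase R n) :
  enorm z = 1 -> enorm e = 1 ->
  exists L : {linear phase R n -> phase R n},
    [/\ forall u v, omega0 (L u) (L v) = omega0 u v,
        forall u, L (mulI u) = mulI (L u) & L z = e].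
Proof.
move=> z1 e1.
have omegaII x y : omega0 (mulI x) y = - omega0 x (mulI y).
  rewrite -[LHS]omega0_mulI mulIK -scaleN1r -[X in omega0 X _]addr0.
  rewrite omega0DZl mulN1r [omega0 0 _]big1 ?addr0 // => i _.
  by rewrite !mxE !mul0r mulr0 subrr.
have normE x : omega0 x (mulI x) = enorm x ^+ 2 by rewrite omega0_mulIr enorm_sqr.
pose v := z - e.
(* [p + i q] is the Hermitian product <z, v>, and [al x + i be x] below is <x, v> / <z, v>. *)
pose p := 1 - omega0 z (mulI e).
pose q := omega0 z e.
pose ri := (p ^+ 2 + q ^+ 2)^-1.
have vE : v = -1 *: e + z by rewrite scaleN1r addrC.
have IvE : mulI v = -1 *: mulI e + mulI z by rewrite vE mulI_DZ.
have zze x : omega0 x x = 0 by apply: big1 => i _; ring.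
have eIz : omega0 e (mulI z) = omega0 z (mulI e) by rewrite omega0C omegaII opprK.
(* |v|^2 = 2 Re <z, v> because [z] and [e] have equal norm; this relation is what makes [f]
   unitary. *)
have vv : omega0 v (mulI v) = 2 * p.
  by rewrite IvE omega0DZr vE !omega0DZl !normE z1 e1 eIz /p; ring.
pose A x := omega0 x (mulI v).
pose B x := omega0 v x.
have Az : A z = p by rewrite /A IvE omega0DZr normE z1 /p; ring.
have Bz : B z = q by rewrite /B vE omega0DZl zze (omega0C e) /q; ring.
pose al x := (p * A x + q * B x) * ri.
pose be x := (p * B x - q * A x) * ri.
pose f (x : phase R n) := - al x *: v + (- be x *: mulI v + x).
have ADZ a x y : A (a *: x + y) = a * A x + A y by exact: omega0DZl.
have BDZ a x y : B (a *: x + y) = a * B x + B y by exact: omega0DZr.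
have flin : linear f.
  move=> a x y; rewrite /f /al /be !ADZ !BDZ.
  apply/matrixP => i j; rewrite !mxE; ring.
pose L : {linear phase R n -> phase R n} :=
  HB.pack f (GRing.isLinear.Build _ _ _ _ f flin).
exists L; split => [u w|u|] /=.
- rewrite /f !omega0DZl !omega0DZr !zze vv.
  rewrite (omega0C u v) (omega0C (mulI v) v) vv (omega0C (mulI v) w).
  rewrite -/(A u) -/(A w) -/(B u) -/(B w) /al /be.
  (* This holds even for [p = q = 0], since the inverse of 0 is 0. *)
  have ri2 : ri ^+ 2 * (p ^+ 2 + q ^+ 2) = ri.
    have [r0|r0] := eqVneq (p ^+ 2 + q ^+ 2) 0; last by rewrite expr2 -mulrA mulVf ?mulr1.
    by rewrite r0 mulr0 /ri r0 invr0.
  apply/eqP; rewrite -subr_eq0; apply/eqP.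
  transitivity (2 * p * (A u * B w - B u * A w)
                * (ri ^+ 2 * (p ^+ 2 + q ^+ 2) - ri)); first ring.
  by rewrite ri2; ring.
- have AI x : A (mulI x) = - B x by rewrite /A omega0_mulI omega0C.
  have BI x : B (mulI x) = A x by rewrite /B omega0C omegaII opprK.
  rewrite /f /al /be !AI !BI !mulI_DZ mulIK.
  apply/matrixP => i j; rewrite !mxE; ring.
(* If <z, v> = 0 then |v|^2 = 2 p = 0, so [z = e] and [f] is the identity. *)
- have [r0|r0] := eqVneq (p ^+ 2 + q ^+ 2) 0.
    have p0 : p = 0.
      by apply/eqP; rewrite -sqrf_eq0 eq_le sqr_ge0 andbT -r0 lerDl sqr_ge0.
    have v0 : v = 0.
      by apply: enorm_eq0; apply/eqP; rewrite -sqrf_eq0 -normE vv p0 mulr0.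
    move: IvE; rewrite /f v0 scaler0 add0r /mulI => _.
    rewrite (_ : \matrix_(_, _) _ = 0) ?scaler0 ?add0r; first exact: subr0_eq.
    by apply/matrixP => i j; rewrite !mxE oppr0 if_same.
  rewrite /f /al /be Az Bz -!expr2 /ri divff // [q * p]mulrC subrr mul0r oppr0.
  by rewrite scale0r add0r scaleN1r /v opprB subrK.
Qed.

(** * Null sets and the unit sphere *)

(* Induction on m: by Fubini, integrate the slice inequality over the last coordinate. *)
Lemma cube_cover (R : realType) (m : nat) (c : R) (a : nat -> nat -> R)
    (w : nat -> R) (P : pred nat) :
  0 <= c -> (forall k, 0 <= w k) ->
  (forall x : nat -> R, (forall j, (j < m)%N -> 0 <= x j <= c) ->
    exists2 k, P k & forall j, (j < m)%N -> a k j <= x j <= a k j + w k) ->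
  ((c ^+ m)%:E <= \sum_(0 <= k <oo) ((P k)%:R * w k ^+ m)%:E)%E.
Proof.
move=> c0 w0; elim: m P => [|m IH] P covP.
  (* In dimension 0 a single box with [P k] suffices: its term is [w k ^+ 0 = 1], even when
     [w k = 0]. *)
  have [//|k Pk _] := covP (fun=> 0).
  have ge0 i : (0 <= ((P i)%:R * w i ^+ 0)%:E)%E by rewrite lee_fin expr0 mulr1.
  apply: le_trans (nneseries_lim_ge k.+1 (fun i _ _ => ge0 i)).
  by rewrite big_nat_recr //= Pk !expr0 mulr1 leeDr // sume_ge0.
pose I k : set R := `[a k m, a k m + w k]%classic.
pose f k (t : R) : \bar R := (((P k)%:R * w k ^+ m)%:E * (\1_(I k) t)%:E)%E.
have f0 k t : (0 <= f k t)%E by rewrite mule_ge0 // lee_fin mulr_ge0 // exprn_ge0.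
have mI k : measurable (I k) by exact: measurable_itv.
pose D : set R := `[0, c]%classic.
have mD : measurable D by exact: measurable_itv.
have mind k : measurable_fun D (EFin \o (\1_(I k) : R -> R)).
  by apply/measurable_EFinP; exact: measurable_indic.
have mf k : measurable_fun D (f k).
  exact: measurable_funeM (mind k).
have slice t : D t -> ((c ^+ m)%:E <= \sum_(0 <= k <oo) f k t)%E.
  (* Only boxes whose last side contains [t] meet the slice at height [t]; the predicate [P] serves
     to drop the others. *)
  move=> Dt; pose Pt k := P k && (t \in I k).
  have -> : (\sum_(0 <= k <oo) f k t = \sum_(0 <= k <oo) ((Pt k)%:R * w k ^+ m)%:E)%E.
    apply: eq_eseriesr => k _; rewrite /f /Pt indicE -EFinM mulrAC -natrM mulnb //.
  apply: IH => x x0c.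
  have [j|k Pk ak] := covP (fun j => if j == m then t else x j).
    rewrite ltnS leq_eqVlt => /orP[/eqP ->|jm].
      by rewrite eqxx; move: Dt; rewrite /D /= in_itv.
    by rewrite ltn_eqF //; exact: x0c.
  exists k => [|j jm].
    rewrite /Pt Pk inE /I /= in_itv /=; have := ak m (ltnSn m).
    by rewrite eqxx.
  by have := ak j (ltnW jm); rewrite ltn_eqF.
have lebD : lebesgue_measure D = c%:E :> \bar R.
  rewrite lebesgue_measure_itv /= lte_fin; case: ltP => [_|cle]; first by rewrite -EFinB subr0.
  by congr EFin; apply/eqP; rewrite eq_le c0 cle.
have lebI k : lebesgue_measure (I k) = (w k)%:E :> \bar R.
  rewrite lebesgue_measure_itv /= lte_fin ltrDl; case: ltP => [_|wle].
    by rewrite -EFinB addrC addKr.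
  by congr EFin; apply/eqP; rewrite eq_le w0 wle.
have -> : ((c ^+ m.+1)%:E = \int[lebesgue_measure]_(t in D) (cst (c ^+ m)%:E t) :> \bar R)%E.
  by rewrite integral_cst // exprSr EFinM; congr (_ * _)%E; exact: esym lebD.
apply: (@le_trans _ _ (\int[lebesgue_measure]_(t in D) (\sum_(0 <= k <oo) f k t))%E).
  apply: ge0_le_integral => //.
  - by move=> t _; rewrite lee_fin exprn_ge0.
  - by apply: (@ge0_emeasurable_sum _ _ _ _ f predT) => [k x _ _|k _]; [exact: f0|exact: mf].
(* After exchanging sum and integral, integrating a term multiplies its weight by the length of
   [I k] in [D], which is at most [w k]. *)
rewrite integral_nneseries //; apply: lee_nneseries => k _.
  by move=> _; apply: integral_ge0.
rewrite /f ge0_integralZl //; [|exact: mind|by rewrite lee_fin mulr_ge0 // exprn_ge0].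
rewrite integral_indic //; last exact: mI.
rewrite exprSr mulrA [in leRHS]EFinM; apply: lee_wpmul2l.
  by rewrite lee_fin mulr_ge0 // exprn_ge0.
rewrite -lebI; apply: le_measure; rewrite ?inE //; last exact: mI.
exact: (measurableI _ _ (mI k) mD).
Qed.

(** Gives the entry (i, j) of a matrix the flat index [2 * i + j], so that the last coordinate can
    be split off. *)
Lemma sum_pairs (R : realType) n (X : nat -> R) :
  \sum_(i < n) (X (2 * i)%N + X (2 * i + 1)%N) = \sum_(j < 2 * n) X j.
Proof.
elim: n => [|n IH]; first by rewrite !big_ord0.
by rewrite big_ord_recr /= IH mulnS add2n !big_ord_recr /= addn1 addrA.
Qed.

Lemma diam_ge (R : realType) n (A : set (phase R n)) x y :
  A x -> A y -> ((enorm (x - y))%:E <= diam A)%E.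
Proof. by move=> Ax Ay; apply: ereal_sup_ubound; exists (x, y). Qed.

(* Dropping the last coordinate maps the sphere 1-Lipschitz-ly onto a set
   containing a small (2n-1)-cube. *)
Lemma null_set_misses_sphere (R : realType) n (K : set (phase R n)) :
  (0 < n)%N -> hausdorff_measure (2 * n - 1)%N%:R K = 0%E ->
  exists2 z, enorm z = 1 & ~ K z.
Proof.
move=> n_gt0 K0; apply: contrapT => noz.
have {noz} sphK z : enorm z = 1 -> K z.
  by move=> z1; apply: contrapT => nKz; apply: noz; exists z.
set N := (2 * n - 1)%N in K0.
have NS : (2 * n = N.+1)%N by rewrite /N; lia.
(* With this side, [N * c ^+ 2 <= 1]: the cube lies in the unit ball of dimension [N], over which
   the upper half of the sphere is a graph. *)
pose c : R := N.+1%:R^-1.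
have c_gt0 : 0 < c by rewrite invr_gt0 ltr0n.
have : (hausdorff_premeasure N%:R 1 K <= 0)%E.
  by rewrite -K0; apply: ereal_sup_ubound; exists 1 => //=; exact: ltr01.
(* A set of diameter [d] lies in a box of side [2 * d]; the threshold absorbs this factor 2 in each
   of the [N] dimensions. *)
have e_gt0 : 0 < (c / 2) ^+ N :> R by rewrite exprn_gt0 // divr_gt0.
move=> /le_lt_trans -/(_ ((c / 2) ^+ N)%:E); rewrite lte_fin => /(_ e_gt0).
move=> /ereal_inf_lt [_ [C [KC Cd] <-] sumC].
pose P k := C k != set0.
pose d k := fine (diam (C k)).
have dE k : P k -> (diam (C k) = (d k)%:E)%E /\ 0 <= d k.
  move=> /set0P [x Cx]; have := diam_ge Cx Cx; have := Cd k; rewrite subrr.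
  have -> : enorm (0 : phase R n) = 0.
    by rewrite /enorm big1 ?sqrtr0 // => i _; rewrite !mxE expr0n addr0.
  by rewrite /d; case: (diam (C k)) => [r| |] //=; rewrite !lee_fin.
(* An empty [C k] has diameter [-oo], which [fine] sends to 0. *)
have d0 k : 0 <= d k.
  have [/dE[]//|/negP] := boolP (P k); rewrite /d /P => /negP; rewrite negbK => /eqP ->.
  rewrite /diam (_ : [set _ | _ in _] = set0) ?ereal_sup0 //.
  by rewrite -subset0 => _ [x [[]]].
(* Flat coordinate [j] sits in row [j./2] and column [odd j]; the default of [insubd] is never
   reached for [j < N]. *)
pose ix j : 'I_n := insubd (Ordinal n_gt0) j./2.
pose ctr k : phase R n := xget 0 (C k).
pose a k j := ctr k (ix j) (inord (odd j)) - d k.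
suff : ((c ^+ N)%:E <= \sum_(0 <= k <oo) ((P k)%:R * (2 * d k) ^+ N)%:E)%E.
  rewrite (_ : (\sum_(0 <= k <oo) _)%E =
      ((2 ^+ N)%:E * \sum_(0 <= k <oo) diam_pow N%:R (C k))%E); last first.
    rewrite -nneseriesZl; last first.
      by move=> k _; rewrite /diam_pow; case: ifP => // _; exact: poweR_ge0.
    apply: eq_eseriesr => k _; rewrite /diam_pow /P.
    case: ifPn => [_|/dE[-> _]] /=; first by rewrite mul0r mule0.
    by rewrite powR_mulrn // mul1r exprMn EFinM.
  apply/negP; rewrite -ltNge.
  have -> : c ^+ N = 2 ^+ N * (c / 2) ^+ N by rewrite -exprMn mulrC divfK.
  by rewrite EFinM lte_pmul2l // lte_fin exprn_gt0.
apply: (@cube_cover R N c a); [exact: ltW|by move=> k; rewrite mulr_ge0|].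
move=> x x0c.
pose S := \sum_(j < N) x j ^+ 2.
(* The last coordinate lifts the point [x] of the cube to the sphere. *)
pose X j := if (j < N)%N then x j else Num.sqrt (1 - S).
pose z : phase R n := \matrix_(i, j) X (2 * i + j)%N.
have S1 : S <= 1.
  apply: (@le_trans _ _ (\sum_(j < N) c)).
    apply: ler_sum => j _; have /andP[x0 xc] := x0c j (ltn_ord j).
    rewrite expr2; apply: le_trans (ler_pM x0 x0 xc xc) _.
    by rewrite ger_pMr // /c invf_le1 ?ltr0n // ler1n.
  rewrite sumr_const card_ord -mulr_natl /c ler_pdivrMr ?ltr0n // mul1r ler_nat.
  exact: leqnSn.
have : K z.
  apply: sphK; rewrite /enorm.
  under eq_bigr do rewrite !mxE /= addn0.
  rewrite (sum_pairs n (fun j => X j ^+ 2)) NS big_ord_recr /= {2}/X ltnn.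
  rewrite sqr_sqrtr ?subr_ge0 //.
  rewrite (_ : \sum_(i < N) _ = S); first by rewrite addrC subrK sqrtr1.
  by apply: eq_bigr => j _; rewrite /X ltn_ord.
move=> /KC [k _ Ckz]; have Pk : P k by apply/set0P; exists z.
exists k => // j jN.
have Cctr : C k (ctr k) by apply: xgetI Ckz.
have := diam_ge Ckz Cctr; rewrite (dE _ Pk).1 lee_fin.
move=> /(le_trans (coord_le_enorm _ (ix j) (inord (odd j)))).
rewrite [in `|_|]mxE mxE [(- ctr k) _ _]mxE.
have j2 : (j./2 < n)%N by have := odd_double_half j; lia.
have -> : (2 * ix j + (inord (odd j) : 'I_2))%N = j.
  rewrite insubdK // inordK; last by case: odd.
  by rewrite mul2n addnC odd_double_half.
rewrite /X jN ler_norml /a; set y := ctr k _ _; set dk := d k => /andP[h1 h2].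
by apply/andP; split; lra.
Qed.

(** * Squeezing the first factor *)

Lemma omega0_delta1 (R : realType) n (x : phase R n) i :
  omega0 x (delta_mx i 1) = x i 0.
Proof.
rewrite /omega0 (bigD1 i) //= big1 ?addr0 => [|j ji]; rewrite !mxE ?eqxx /=; first by ring.
by rewrite (negbTE ji) /=; ring.
Qed.

Lemma omega0_delta0 (R : realType) n (x : phase R n) i :
  omega0 x (delta_mx i 0) = - x i 1.
Proof.
rewrite /omega0 (bigD1 i) //= big1 ?addr0 => [|j ji]; rewrite !mxE ?eqxx /=; first by ring.
by rewrite (negbTE ji) /=; ring.
Qed.

Lemma omega0_nondegenerate (R : realType) n (x : phase R n) :
  (forall y, omega0 x y = 0) -> x = 0.
Proof.
move=> x0; apply/matrixP => i j; rewrite mxE; case: (ord2P j) => ->.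
  by rewrite -omega0_delta1 x0.
by apply: oppr_inj; rewrite -omega0_delta0 x0 oppr0.
Qed.

(** The left inverse is the symplectic adjoint: the coordinates of [x] are, up to sign, its pairings
    with basis vectors, and [L] preserves these pairings. *)
Lemma omega0_linv (R : realType) n (L : phase R n -> phase R n) :
  (forall u v, omega0 (L u) (L v) = omega0 u v) ->
  exists L' : {linear phase R n -> phase R n}, forall x, L' (L x) = x.
Proof.
move=> LL; pose f (y : phase R n) : phase R n := \matrix_(i, j)
  (if j == 0 then omega0 y (L (delta_mx i 1)) else - omega0 y (L (delta_mx i 0))).
have flin : linear f.
  move=> a x y; apply/matrixP => i j; rewrite !mxE.
  by case: ifP => _; rewrite omega0DZl //; ring.
pose L' : {linear phase R n -> phase R n} :=
  HB.pack f (GRing.isLinear.Build _ _ _ _ f flin).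
exists L' => x; apply/matrixP => i j; rewrite !mxE !LL omega0_delta0 omega0_delta1 opprK.
by case: (ord2P j) => ->.
Qed.

Section squeeze.
Variables (R : realType) (n : nat) (i0 : 'I_n) (e : R) (e_gt0 : 0 < e).
Variables (L : {linear phase R n -> phase R n}).
Hypothesis omega0_L : forall u v, omega0 (L u) (L v) = omega0 u v.

Let Q (x : phase R n) : R := L x i0 0.
Let P (x : phase R n) : R := L x i0 1.
(** As g' q = D / (1 - q)^2, the quotient p / g' q equals p - e p / D. *)
Let D (x : phase R n) : R := (1 - Q x) ^+ 2 + e.

(* In the coordinates (q, p) of the factor i0 of L x this is the map
   (q, p) |-> (g q, p / g' q) with g q = q + e / (1 - q), for q < 1. *)
Definition squeeze (x : phase R n) : phase R n :=
  L x + (e * (1 - Q x)^-1) *: delta_mx i0 0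
      + (- e * (P x * (D x)^-1)) *: delta_mx i0 1.

Lemma squeeze0 x : squeeze x i0 0 = Q x + e / (1 - Q x).
Proof. by rewrite /squeeze !mxE eqxx /= mulr1 mulr0 addr0. Qed.

Lemma squeeze1 x : Q x < 1 ->
  squeeze x i0 1 = P x * (1 - Q x) ^+ 2 / ((1 - Q x) ^+ 2 + e).
Proof.
move=> Q1; rewrite /squeeze !mxE eqxx /= mulr1 mulr0 addr0 -/(P x) /D.
field; rewrite gt_eqF // addr_gt0 // exprn_gt0 // subr_gt0 //.
Qed.

Let D_neq0 x : D x != 0.
Proof. by rewrite gt_eqF // ltr_wpDl // sqr_ge0. Qed.

Let linP : linear P.
Proof. by move=> a x y; rewrite /P linearP !mxE. Qed.
Let linQ : linear Q.
Proof. by move=> a x y; rewrite /Q linearP !mxE. Qed.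
Let lP : {linear phase R n -> R} := HB.pack P (GRing.isLinear.Build _ _ _ _ P linP).
Let lQ : {linear phase R n -> R} := HB.pack Q (GRing.isLinear.Build _ _ _ _ Q linQ).

Let is_diffP x : is_diff x P P.
Proof.
apply: DiffDef; first exact: (linear_differentiable (f := lP) x (mx_linear_continuous (f := lP))).
exact: (diff_lin (f := lP) x (mx_linear_continuous (f := lP))).
Qed.
Let is_diffQ x : is_diff x Q Q.
Proof.
apply: DiffDef; first exact: (linear_differentiable (f := lQ) x (mx_linear_continuous (f := lQ))).
exact: (diff_lin (f := lQ) x (mx_linear_continuous (f := lQ))).
Qed.

Lemma is_diff_squeeze x : Q x < 1 -> is_diff x squeeze
  (fun u => L u + (e * (Q u / (1 - Q x) ^+ 2)) *: delta_mx i0 0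
    + (- e * (P u / D x + P x * (2 * (1 - Q x) * Q u) / D x ^+ 2)) *: delta_mx i0 1).
Proof.
move=> Q1; have Q0 : 1 - Q x != 0 by rewrite subr_eq0 gt_eqF.
have dL : is_diff x L L.
  apply: DiffDef; first exact: (linear_differentiable x (mx_linear_continuous (f := L))).
  exact: (diff_lin x (mx_linear_continuous (f := L))).
have d1 : is_diff x (fun y => 1 - Q y) (- Q).
  by have := is_diffB (is_diff_cst (1 : R) x) (is_diffQ x); rewrite sub0r.
have d1V : is_diff x (fun y => (1 - Q y)^-1) (fun u => Q u / (1 - Q x) ^+ 2).
  apply: DiffDef; first exact: differentiableV.
  rewrite diffV // diff_val; apply/funext => u.
  by rewrite !fctE -[LHS]/(- (1 - Q x) ^- 2 * - Q u) mulrNN mulrC.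
have dD : is_diff x D (fun u => - (2 * (1 - Q x) * Q u)).
  have -> : D = (fun y => 1 - Q y) * (fun y => 1 - Q y) + cst e.
    by apply/funext => y; rewrite !fctE -expr2.
  apply: (is_diff_eq (is_diffD (is_diffM d1 d1) (is_diff_cst e x))).
  apply/funext => u; rewrite !fctE addr0.
  rewrite -[LHS]/((1 - Q x) * - Q u + (1 - Q x) * - Q u); ring.
have dDV : is_diff x (fun y => (D y)^-1) (fun u => (2 * (1 - Q x) * Q u) / D x ^+ 2).
  apply: DiffDef; first exact: differentiableV.
  rewrite diffV // diff_val; apply/funext => u.
  by rewrite -[LHS]/(- D x ^- 2 * - (2 * (1 - Q x) * Q u)) mulrNN mulrC.
have ds0 : is_diff x (fun y => e * (1 - Q y)^-1) (fun u => e * (Q u / (1 - Q x) ^+ 2)).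
  exact: (is_diffZ e d1V).
have ds1 : is_diff x (fun y => - e * (P y * (D y)^-1))
    (fun u => - e * (P u / D x + P x * (2 * (1 - Q x) * Q u) / D x ^+ 2)).
  apply: (is_diff_eq (is_diffZ (- e) (is_diffM (is_diffP x) dDV))).
  apply/funext => u; rewrite !fctE.
  rewrite -[LHS]/(- e * (P x * (2 * (1 - Q x) * Q u / D x ^+ 2) + (D x)^-1 * P u)); ring.
have dE (s ds : phase R n -> R) (w : phase R n) :
    is_diff x s ds -> is_diff x (fun y => s y *: w) (fun u => ds u *: w).
  move=> dss; apply: DiffDef; first exact: differentiableZl.
  by rewrite diffZl // diff_val.
exact: is_diffD (is_diffD dL (dE _ _ _ ds0)) (dE _ _ _ ds1).
Qed.

Lemma squeeze_smooth U : open U -> U `<=` [set x | Q x < 1] -> smooth_on U squeeze.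
Proof.
move=> oU UQ k.
have CP : Ck_on U k P by exact: (Ck_on_linear _ _ (mx_linear_continuous (f := lP))).
have CQ : Ck_on U k Q by exact: (Ck_on_linear _ _ (mx_linear_continuous (f := lQ))).
have C1 : Ck_on U k (fun x => 1 - Q x).
  apply: (@Ck_on_eq _ _ _ U k (cst 1 + cst (-1) * Q)) => // [x _|].
    by rewrite !fctE mulN1r.
  by apply: Ck_onD => //; [exact: Ck_on_cst|apply: Ck_onM => //; exact: Ck_on_cst].
have CD : Ck_on U k D.
  apply: Ck_onD => //; last exact: Ck_on_cst.
  exact: (Ck_onM (f := fun x => 1 - Q x) oU C1 C1).
apply: Ck_onD => //; first apply: Ck_onD => //.
- exact: (Ck_on_linear _ _ (mx_linear_continuous (f := L))).
- apply: Ck_onZl => //; apply: (Ck_onM (f := cst e)) => //; first exact: Ck_on_cst.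
  by apply: Ck_onV => // x /UQ; rewrite /= -subr_gt0 => /lt0r_neq0.
- apply: Ck_onZl => //; apply: (Ck_onM (f := cst (- e))) => //; first exact: Ck_on_cst.
  by apply: (Ck_onM (f := P)) => //; apply: Ck_onV.
Qed.

Lemma squeeze_symplectic U : U `<=` [set x | Q x < 1] -> symplectic_on U squeeze.
Proof.
move=> UQ x /UQ /= Q1 u v.
have Q0 : 1 - Q x != 0 by rewrite subr_eq0 gt_eqF.
have sq := is_diff_squeeze Q1; rewrite diff_val.
set s0 := fun u => e * (Q u / (1 - Q x) ^+ 2).
set s1 := fun u => - e * (P u / D x + P x * (2 * (1 - Q x) * Q u) / D x ^+ 2).
(* Used in both arguments through antisymmetry, this reduces the claim to a rational identity: the
   planar map has Jacobian determinant 1. *)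
have E x0 y a b : omega0 (x0 + a *: delta_mx i0 0 + b *: delta_mx i0 1) y
    = omega0 x0 y + a * y i0 1 - b * y i0 0.
  rewrite addrC omega0DZl addrC [x0 + _]addrC omega0DZl.
  rewrite (omega0C (delta_mx _ 0)) (omega0C (delta_mx _ 1)) omega0_delta0 omega0_delta1.
  by rewrite opprK; ring.
rewrite E omega0C E omega0C omega0_L !mxE eqxx /= -/(P u) -/(P v) -/(Q u) -/(Q v).
rewrite /s0 /s1 /D; field.
by rewrite Q0 D_neq0.
Qed.

Lemma squeeze_linv : exists g : phase R n -> phase R n,
  (forall x, Q x < 1 -> g (squeeze x) = x) /\ continuous g.
Proof.
have [L' L'K] := omega0_linv omega0_L.
pose s (y : phase R n) := 1 - y i0 0.
(* Inverts the first coordinate: for t = 1 - q, the image satisfies s = t - e / t, so t is the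
   positive root of t^2 - s t - e. Since e > 0, this root is positive for every [y], which makes the
   inverse continuous everywhere. *)
pose t (y : phase R n) := (s y + Num.sqrt (s y * s y + 4 * e)) / 2.
have t_gt0 y : 0 < t y.
  rewrite /t divr_gt0 // -ltrBlDl sub0r.
  apply: le_lt_trans (ler_norm _) _; rewrite normrN -sqrtr_sqr expr2.
  by rewrite ltr_sqrt ?ltrDl ?mulr_gt0 // ltr_wpDl ?mulr_gt0 // -expr2 sqr_ge0.
(* Restores q = 1 - t, and p by multiplying with g' q = 1 + e / t^2. *)
pose h (y : phase R n) : phase R n := y + (s y - t y) *: delta_mx i0 0
  + (y i0 1 * e * (t y * t y)^-1) *: delta_mx i0 1.
exists (L' \o h); split.
  move=> x Q1.
  have Q0 : 0 < 1 - Q x by rewrite subr_gt0.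
  have tE : t (squeeze x) = 1 - Q x.
    rewrite /t /s squeeze0.
    rewrite (_ : _ * _ + 4 * e = (1 - Q x + e / (1 - Q x)) ^+ 2); last first.
      by field; rewrite gt_eqF.
    rewrite sqrtr_sqr gtr0_norm; last by rewrite addr_gt0 // divr_gt0.
    by field; rewrite gt_eqF.
  rewrite -[RHS]L'K; congr (L' _).
  rewrite /h tE squeeze1 // /s squeeze0 /squeeze.
  have cancel (w A B : phase R n) a b c d : a + c = 0 -> b + d = 0 ->
      w + a *: A + b *: B + c *: A + d *: B = w.
    move=> ac bd; rewrite (addrAC _ (b *: B)) -(addrA w) -scalerDl ac scale0r addr0.
    by rewrite -addrA -scalerDl bd scale0r addr0.
  apply: cancel; first by ring.
  by rewrite /D; field; rewrite D_neq0 gt_eqF.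
have ccoord i j : continuous (fun y : phase R n => y i j) by exact: coord_continuous.
have cs : continuous s by move=> y; exact: (cvgB (cvg_cst (1 : R)) (ccoord i0 0 y)).
have ct : continuous t.
  move=> y; have csq : {for y, continuous (fun y => Num.sqrt (s y * s y + 4 * e))}.
    apply: continuous_comp; last exact: sqrt_continuous.
    exact: (cvgD (cvgM (cs y) (cs y)) (cvg_cst (4 * e))).
  exact: (cvgM (cvgD (cs y) csq) (cvg_cst (2^-1 : R))).
move=> y; apply: continuous_comp; last exact: (mx_linear_continuous (f := L')).
have ctV : {for y, continuous (fun y => (t y * t y)^-1)}.
  apply: continuousV; first by rewrite mulf_neq0 // gt_eqF.
  exact: cvgM (ct y) (ct y).
have cq := cvgB (cs y) (ct y).
have cp := cvgM (cvgM (ccoord i0 1 y) (cvg_cst e)) ctV.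
have c0 : {for y, continuous (fun y => (s y - t y) *: delta_mx i0 0 : phase R n)}.
  apply: continuousZr_tmp; exact: cq.
have c1 : {for y, continuous (fun y : phase R n =>
    (y i0 1 * e * (t y * t y)^-1) *: delta_mx i0 1 : phase R n)}.
  apply: continuousZr_tmp; exact: cp.
have cid : {for y, continuous (fun y : phase R n => y)} by exact: cvg_id.
exact: (cvgD (cvgD cid c0) c1).
Qed.

(** The differential is injective because it preserves a nondegenerate form; the inverse on the
    image restricts a globally continuous map. *)
Lemma squeeze_embedding U : open U -> U `<=` [set x | Q x < 1] -> smooth_embedding U squeeze.
Proof.
move=> oU UQ; split; first exact: squeeze_smooth.
  move=> x Ux u v duv; apply/subr0_eq/omega0_nondegenerate => y.
  rewrite -(squeeze_symplectic UQ Ux) linearB /= duv subrr.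
  by rewrite /omega0 big1 // => i _; rewrite !mxE !mul0r mulr0 subrr.
have [g [gK cg]] := squeeze_linv.
exists g; split=> [x /UQ Q1|]; first exact: gK.
exact: continuous_subspaceT.
Qed.
End squeeze.

(* On the unit circle the left-hand side is 1 - 2 e / (1 - q) + O(e ^ 2). *)
Lemma squeeze_in_disk (R : realFieldType) (d q p : R) :
  0 < d -> q <= 1 - d -> q ^+ 2 + p ^+ 2 <= 1 ->
  forall e, e = d ^+ 2 / 4 ->
  (q + e / (1 - q)) ^+ 2 + (p * (1 - q) ^+ 2 / ((1 - q) ^+ 2 + e)) ^+ 2 < 1.
Proof.
move=> d0 qd qp e eE.
set t := 1 - q; have qE : q = 1 - t by rewrite /t; ring.
have td : d <= t by rewrite /t; lra.
have t0 : 0 < t by apply: lt_le_trans td.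
have e0 : 0 < e by rewrite eE divr_gt0 // exprn_gt0.
have et : e <= t ^+ 2 / 4.
  by rewrite eE ler_pM2r ?invr_gt0 // ler_pXn2r // nnegrE ltW.
have pt : p ^+ 2 <= t * (2 - t) by move: qp; rewrite qE; nra.
have te0 : 0 < t ^+ 2 + e by rewrite addr_gt0 // exprn_gt0.
(* Denominators are cleared in 1 - (q + e / t)^2 = (t^2 - e) (2 t - t^2 + e) / t^2, where q = 1 -
   t. *)
suff main : p ^+ 2 * t ^+ 6 < (t ^+ 2 - e) * (2 * t - t ^+ 2 + e) * (t ^+ 2 + e) ^+ 2.
  rewrite qE -subr_gt0.
  rewrite (_ : _ - _ = ((t ^+ 2 - e) * (2 * t - t ^+ 2 + e) * (t ^+ 2 + e) ^+ 2
      - p ^+ 2 * t ^+ 6) / (t ^+ 2 * (t ^+ 2 + e) ^+ 2)); last first.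
    by field; rewrite !gt_eqF.
  by rewrite divr_gt0 ?subr_gt0 // mulr_gt0 // exprn_gt0.
apply: (@le_lt_trans _ _ (t * (2 - t) * t ^+ 6)).
  by rewrite ler_wpM2r // exprn_ge0 // ltW.
rewrite -subr_gt0.
(* The order 0 terms in [e] cancel on the unit circle; the leading gain is [2 * e * t ^+ 5]. *)
rewrite (_ : _ - _ = e * (2 * t ^+ 5 + e * t ^+ 4
    - e * (2 * t ^+ 3 - t ^+ 4 + 2 * e * t + e ^+ 2))); last by ring.
rewrite mulr_gt0 //.
have t3 : 0 < t ^+ 3 by rewrite exprn_gt0.
have t2 : 0 < t ^+ 2 by rewrite exprn_gt0.
(* By [e <= t ^+ 2 / 4], each negative term is at most a small fraction of [t ^+ 5] or
   [e * t ^+ 4]. *)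
have h1 : e * t ^+ 3 <= t ^+ 5 / 4.
  by rewrite (_ : t ^+ 5 / 4 = t ^+ 2 / 4 * t ^+ 3) ?ler_pM2r //; field.
have e2 : e ^+ 2 <= (t ^+ 2 / 4) ^+ 2 by rewrite ler_pXn2r // nnegrE ?divr_ge0 // ltW.
have h2 : e ^+ 2 * t <= t ^+ 5 / 16.
  by rewrite (_ : t ^+ 5 / 16 = (t ^+ 2 / 4) ^+ 2 * t) ?ler_pM2r //; field.
have h3 : e ^+ 3 <= e * t ^+ 4 / 16.
  rewrite exprS (_ : e * t ^+ 4 / 16 = e * (t ^+ 2 / 4) ^+ 2); last by field.
  by rewrite ler_pM2l.
have t5 : 0 < t ^+ 5 by rewrite exprn_gt0.
have et4 : 0 < e * t ^+ 4 by rewrite mulr_gt0 // exprn_gt0.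
rewrite (_ : _ - _ = 2 * t ^+ 5 + 2 * (e * t ^+ 4) - 2 * (e * t ^+ 3)
    - 2 * (e ^+ 2 * t) - e ^+ 3); last by ring.
lra.
Qed.

(** * Euclidean geometry and assembly of the embedding *)

Lemma open_cylinder (R : realType) n (n_gt0 : (0 < n)%N) : open (cylinder R n_gt0).
Proof.
set i := Ordinal n_gt0.
have c : continuous (fun y : phase R n => y i 0 * y i 0 + y i 1 * y i 1).
  move=> y; have c0 := @coord_continuous R n 2 i 0 y.
  have c1 := @coord_continuous R n 2 i 1 y.
  exact: (cvgD (cvgM c0 c0) (cvgM c1 c1)).
have -> : cylinder R n_gt0 =
  (fun y : phase R n => y i 0 * y i 0 + y i 1 * y i 1) @^-1` [set r | r < 1] by [].
by apply: open_comp => [y _|]; [exact: c|exact: open_lt].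
Qed.

Lemma enorm_delta (R : realType) n (i : 'I_n) : enorm (delta_mx i 0 : phase R n) = 1.
Proof.
rewrite /enorm (bigD1 i) //= big1 => [|j ji]; rewrite !mxE ?eqxx /=.
  by rewrite expr1n expr0n !addr0 sqrtr1.
by rewrite (negbTE ji) /= expr0n addr0.
Qed.

Lemma mulI_delta (R : realType) n (i : 'I_n) :
  mulI (delta_mx i 0) = delta_mx i 1 :> phase R n.
Proof.
apply/matrixP => k j; rewrite !mxE andbF andbT.
by case: (ord2P j) => -> /=; rewrite ?andbF ?andbT ?oppr0.
Qed.

(** Law of cosines: [omega0 x (mulI z)] is the Euclidean inner product of [x] and [z]. *)
Lemma enormB_sqr (R : realType) n (x z : phase R n) :
  enorm (x - z) ^+ 2 = enorm x ^+ 2 + enorm z ^+ 2 - 2 * omega0 x (mulI z).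
Proof.
rewrite !enorm_sqr mulr_sumr -big_split -sumrB /=.
by apply: eq_bigr => i _; rewrite !mxE /=; ring.
Qed.

Theorem proposition2 (R : realType) (n : nat) (n_gt0 : (0 < n)%N)
    (K : set (phase R n)) (K_compact : compact K)
    (K_ball : K `<=` closed_unit_ball R n)
    (K_null : hausdorff_measure (2 * n - 1)%N%:R K = 0%E) :
  symplectically_embeds K (cylinder R n_gt0).
Proof.
have [z z1 nKz] := null_set_misses_sphere n_gt0 K_null.
set i0 := Ordinal n_gt0.
have [L [LL LI Lz]] := unitary_transitive z1 (enorm_delta R i0).
pose Q x := L x i0 0.
(* [L] is unitary and sends [z] to e1, so the first coordinate of [L x] is the inner product of [x]
   and [z]. *)
have QE x : Q x = omega0 x (mulI z).
  by rewrite /Q -omega0_delta1 -mulI_delta -Lz -LI LL.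
have K1 x : K x -> enorm x ^+ 2 <= 1.
  by move=> /K_ball ?; rewrite expr_le1 // sqrtr_ge0.
(* Since [x] differs from [z] and |x| <= 1 = |z|, 0 < |x - z|^2 <= 2 - 2 [Q x]. *)
have QK x : K x -> Q x < 1.
  move=> Kx; have : 0 < enorm (x - z) ^+ 2.
    rewrite exprn_gt0 // lt_neqAle sqrtr_ge0 andbT eq_sym.
    apply: contra_notN nKz => /eqP/enorm_eq0/subr0_eq <- //.
  by rewrite enormB_sqr z1 -QE; have := K1 _ Kx; lra.
have cQ : continuous Q.
  move=> x; apply: (continuous_comp (f := L) (g := fun y : phase R n => y i0 0)).
    exact: mx_linear_continuous.
  exact: coord_continuous.
have oQ : open [set x | Q x < 1].
  by apply: (open_comp (D := [set r : R | r < 1])) => [y _|]; [exact: cQ|exact: open_lt].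
have [d d0 Qd] : exists2 d, 0 < d & forall x, K x -> Q x <= 1 - d.
  have [->|/set0P K0] := eqVneq K set0; first by exists 1.
  (* [Q] attains its maximum on the compact set [K], and this maximum is below 1. *)
  have [c /set_mem Kc Qc] := compact_EVT_max K0 K_compact (continuous_subspaceT cQ).
  exists (1 - Q c); first by rewrite subr_gt0 QK.
  by move=> x Kx; rewrite opprB addrC subrK Qc // inE.
pose e := d ^+ 2 / 4.
have e_gt0 : 0 < e by rewrite divr_gt0 // exprn_gt0.
pose f := squeeze i0 e L.
(* Intersecting with the preimage of the open cylinder forces the image of the whole neighborhood
   into it. *)
pose U := [set x | Q x < 1] `&` f @^-1` cylinder R n_gt0.
have UQ : U `<=` [set x | Q x < 1] by move=> x [].
have oU : open U.
  rewrite openE => x [Qx Zx]; apply: filterI; first exact: open_nbhs_nbhs.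
  have cf := Ck_on_continuous (squeeze_smooth e_gt0 oQ (fun x => id) 0) Qx.
  by apply: cf; apply: open_nbhs_nbhs; split => //; exact: open_cylinder.
exists U, f; split => //.
- move=> x Kx; split; first exact: QK.
  rewrite /f /cylinder /= squeeze0 squeeze1 ?QK //; apply: (squeeze_in_disk d0) => //.
    exact: Qd.
  (* The first factor of [L x] is bounded by |L x| = |x|, as [L] is unitary. *)
  apply: le_trans (coord_sqr_le_enorm _ _) _.
  by rewrite enorm_sqr -omega0_mulIr -LI LL omega0_mulIr -enorm_sqr K1.
- by move=> _ [x [_ ?] <-].
- exact: squeeze_embedding.
- exact: squeeze_symplectic.
Qed.
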